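(* For any integers $k\ge 1$ and $n\ge k+2$ there exist a variety $V\subseteq\mathbf{C}^{n-k}$ and a variety $U\subseteq\mathbf{C}^n$ such that $U$ is not a cylinder in $\mathbf{C}^n$, while $U$ and $V\times\mathbf{C}^k$ (both regarded as subvarieties of $\mathbf{C}^{2n}$ via $\mathbf{C}^n=\{x_{n+1}=\dots=x_{2n}=0\}$) are equivalent in $\mathbf{C}^{2n}$.
   Context: A variety $V(p_1,\dots,p_m)\subseteq\mathbf{C}^n$ is the affine variety defined by polynomials $p_i\in\mathbf{C}[x_1,\dots,x_n]$. Two varieties $V(p_1,\dots,p_m)$, $V(q_1,\dots,q_r)$ in $\mathbf{C}^n$ are equivalent if some automorphism of $\mathbf{C}[x_1,\dots,x_n]$ maps the ideal $\langle p_1,\dots,p_m\rangle$ onto $\langle q_1,\dots,q_r\rangle$. If $V=V(p_1,\dots,p_m)\subseteq\mathbf{C}^{n-k}$ with $p_i\in\mathbf{C}[x_1,\dots,x_{n-k}]$, then $V\times\mathbf{C}^k$ is the variety in $\mathbf{C}^n$ defined by the same polynomials. A cylinder in $\mathbf{C}^n$ is a variety equivalent in $\mathbf{C}^n$ to one of the form $W\times\mathbf{C}$ with $W\subseteq\mathbf{C}^{n-1}$. A variety $V(p_1,\dots,p_m)\subseteq\mathbf{C}^n$ is regarded in $\mathbf{C}^{2n}$ as $V(p_1,\dots,p_m,x_{n+1},\dots,x_{2n})$. *)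

(* Defs.v *)
From HB Require Import structures.
From mathcomp Require Import all_boot all_order all_algebra.
From mathcomp Require Import Rstruct.
From mathcomp Require Import complex.
From mathcomp Require Import mpoly.
From Stdlib Require Import Reals.

Set Implicit Arguments. Unset Strict Implicit. Unset Printing Implicit Defensive.
Import Order.TTheory GRing.Theory Num.Theory.
Local Open Scope ring_scope.

Definition CC : numClosedFieldType := (Rdefinitions.R)[i].

Notation Pol n := {mpoly CC[n]}.

(* the variable x_(i+1) of C[x_1..x_n] if i < n, else 0 *)
Definition Xn (n : nat) (i : nat) : Pol n :=
  oapp (fun j : 'I_n => 'X_j) 0 (insub i).

Definition lift_pol (m n : nat) (p : Pol m) : Pol n :=
  p \mPo [tuple Xn n i | i < m].

Definition in_ideal (n : nat) (ps : seq (Pol n)) (q : Pol n) : Prop :=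
  exists cs : seq (Pol n), q = \sum_(i < size ps) cs`_i * ps`_i.

Definition is_aut (n : nat) (f : Pol n -> Pol n) : Prop :=
  [/\ forall p q, f (p + q) = f p + f q,
      forall p q, f (p * q) = f p * f q,
      forall c : CC, f c%:MP = c%:MP
    & bijective f].

(* V(ps) and V(qs) equivalent in C^n: some automorphism maps <ps> onto <qs> *)
Definition equiv_var (n : nat) (ps qs : seq (Pol n)) : Prop :=
  exists f : Pol n -> Pol n, is_aut f /\
    (forall q, in_ideal qs q <-> exists2 p, in_ideal ps p & f p = q).

(* V(ps) in C^n is a cylinder: equivalent to W x C with W in C^(n-1) *)
Definition cylinder (n : nat) (ps : seq (Pol n)) : Prop :=
  exists ws : seq (Pol n.-1), equiv_var ps (map (@lift_pol n.-1 n) ws).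

(* V(ps) in C^n regarded in C^(2n): V(ps, x_(n+1), ..., x_(2n)) *)
Definition to_double (n : nat) (ps : seq (Pol n)) : seq (Pol (n + n)) :=
  map (@lift_pol n (n + n)) ps ++ [seq Xn (n + n) j | j <- iota n n].

(* Main.v *)
Require Import Defs.
From HB Require Import structures.
From mathcomp Require Import all_boot all_order all_algebra.
From mathcomp Require Import Rstruct complex mpoly.
From mathcomp Require Import ring.
Import GRing.Theory Num.Theory.
Local Open Scope ring_scope.

(** Write x, y, z_3, ..., z_n for the coordinates and Q for the sum of the
    z_i^2.  Take V = {xy = 1} and U = {p = 1} with p = x(xy + Q).  Both U and
    V x C^k are isomorphic to C^* x C^(n-2), through w = xy + Q on U and
    y = w(w - Q) on V x C^k; storing one of y, w in a single extra coordinate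
    makes this isomorphism the restriction of an automorphism.

    If an automorphism f straightened U into a cylinder, then
    f(p - 1) would divide its derivative along the last variable, which is
    therefore zero for degree reasons.  Conjugating this derivative by f gives a
    derivation D with D(p) = 0 and D(s) = 1 for some s.  But p is homogeneous of
    degree 3 with linearly independent partial derivatives, so D(p) = 0 forces
    all D(x_i) to vanish at the origin, and then so does D(s). *)

(** * Induction on polynomials; monomials, degrees and partial derivatives *)

Lemma mpoly_alg_ind {n : nat} {R : comNzRingType} (P : {mpoly R[n]} -> Prop) :
  (forall c, P c%:MP) -> (forall i, P 'X_i) ->
  (forall p q, P p -> P q -> P (p + q)) ->
  (forall p q, P p -> P q -> P (p * q)) -> forall p, P p.
Proof.
move=> PC PX PD PM; elim/mpolyind => [|c m p _ _ Pp]; first by rewrite -mpolyC0.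
apply: PD => //; rewrite -mul_mpolyC; apply: (PM) => //.
rewrite mpolyXE_id; apply: (big_ind P) => [|p1 p2 P1 P2|i _].
- by rewrite -mpolyC1.
- exact: PM.
by elim: (m i) => [|k IH]; rewrite ?expr0 ?exprS -?mpolyC1 //; apply: PM.
Qed.

Lemma eq_mnm1D {n : nat} (i j k l : 'I_n) :
  ((U_(i) + U_(j) == U_(k) + U_(l))%MM) =
  ((i == k) && (j == l)) || ((i == l) && (j == k)).
Proof.
apply/eqP/orP => [E|[/andP[/eqP-> /eqP->] //|/andP[/eqP-> /eqP->]]]; last first.
  by rewrite addmC.
have [ik|nik] := eqVneq i k.
  left; move: E; rewrite ik => E /=.
  by rewrite -eq_mnm1; apply/eqP; apply: (@addmI _ U_(k)%MM).
have /eqP li : l == i.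
  have /mnmP/(_ i) := E; rewrite !mnmDE !mnm1E eqxx [k == i]eq_sym (negPf nik).
  by case: (l == i).
right; move: E; rewrite li eqxx addmC => E /=.
by rewrite -eq_mnm1; apply/eqP; apply: (@addIm _ U_(i)%MM).
Qed.

(** Every monomial of the product is [m] times a monomial of [p]; it can keep the degree of [m] only
    if it comes from the constant term of [p]. *)
Lemma mcoeffMX_mdeg {n : nat} {R : comNzRingType} (p : {mpoly R[n]})
    (m m' : 'X_{1..n}) :
  mdeg m = mdeg m' -> (p * 'X_[m])@_m' = p@_0%MM *+ (m == m').
Proof.
move=> mm'; have [<-|ne] := eqVneq m m'; first by rewrite -{1}[m]addm0 mcoeffMX.
apply/eqP; rewrite mulr0n mcoeff_eq0 (perm_mem (msuppMX _ _)).
apply/mapP => -[u _ E]; move: mm'; rewrite E mdegD => /eqP.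
rewrite -[X in X == _]addn0 eqn_add2l eq_sym mdeg_eq0 => /eqP u0.
by move: ne; rewrite E u0 addm0 eqxx.
Qed.

Lemma mcoeffM_quadratic {n : nat} {R : comNzRingType} (p : {mpoly R[n]})
    (i j k l : 'I_n) :
  (p * ('X_i * 'X_j))@_(U_(k) + U_(l))%MM =
  p@_0%MM *+ (((i == k) && (j == l)) || ((i == l) && (j == k))).
Proof.
by rewrite -mpolyXD mcoeffMX_mdeg ?eq_mnm1D // !mdegD !mdeg1.
Qed.

(** The leading monomial of a nonzero derivative, multiplied by ['X_i], is a monomial of [p] of
    degree one higher. *)
Lemma msize_mderiv {n : nat} {R : comNzRingType} (i : 'I_n) (p : {mpoly R[n]}) :
  p != 0 -> (msize p^`M(i) < msize p)%N.
Proof.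
move=> p0; rewrite (mpolySpred _ p0) ltnS.
have [->|d0] := eqVneq p^`M(i) 0; first by rewrite msize0.
have h : mlead p^`M(i) \in msupp p^`M(i) by rewrite mlead_supp.
rewrite -(mlead_deg d0) -ltnS -(mpolySpred _ p0).
move: h; rewrite mcoeff_msupp mcoeff_mderiv => h.
have : (mlead p^`M(i) + U_(i))%MM \in msupp p.
  by rewrite mcoeff_msupp; apply: contraNneq h => ->; rewrite mul0rn.
by move/msize_mdeg_lt; rewrite mdegD mdeg1 addn1.
Qed.

(** Over a domain a nonzero multiple of [p] has at least the degree of [p], whereas differentiation
    lowers the degree. *)
Lemma mderiv_dvd_eq0 {n : nat} {R : idomainType} (i : 'I_n)
    (p h : {mpoly R[n]}) : p^`M(i) = h * p -> p^`M(i) = 0.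
Proof.
move=> E; have [-> |p0] := eqVneq p 0; first by rewrite mderiv0.
have [h0|h0] := eqVneq h 0; first by rewrite E h0 mul0r.
have := msize_mderiv i _ p0; rewrite E msizeM // (mpolySpred _ h0) addSn /=.
by rewrite ltnNge leq_addl.
Qed.

(** * Ideals, automorphisms and a criterion for equivalence *)

Section Ideal.
Context {n : nat} {ps : seq (Pol n)}.
Implicit Types q : Pol n.

Lemma in_ideal_ind (P : Pol n -> Prop) :
  P 0 -> (forall p q, P p -> P q -> P (p + q)) ->
  (forall c p, p \in ps -> P (c * p)) -> forall q, in_ideal ps q -> P q.
Proof.
move=> P0 PD PM q [cs ->]; apply: big_ind => // i _.
by apply: PM; rewrite mem_nth.
Qed.

Lemma in_idealD q1 q2 : in_ideal ps q1 -> in_ideal ps q2 -> in_ideal ps (q1 + q2).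
Proof.
move=> [c1 ->] [c2 ->]; exists (mkseq (fun i => c1`_i + c2`_i) (size ps)).
by rewrite -big_split; apply: eq_bigr => i _; rewrite nth_mkseq //= mulrDl.
Qed.

Lemma in_idealM c q : in_ideal ps q -> in_ideal ps (c * q).
Proof.
move=> [c1 ->]; exists (mkseq (fun i => c * c1`_i) (size ps)).
by rewrite mulr_sumr; apply: eq_bigr => i _; rewrite nth_mkseq //= mulrA.
Qed.

Lemma in_ideal0 : in_ideal ps 0.
(* The empty coefficient list suffices, since missing entries read as 0. *)
Proof. by exists [::]; rewrite big1 // => i _; rewrite nth_nil mul0r. Qed.

Lemma in_ideal_mem q : q \in ps -> in_ideal ps q.
Proof.
move=> qps; exists (mkseq (fun i => (i == index q ps)%:R) (size ps)).
have lt_q : (index q ps < size ps)%N by rewrite index_mem.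
rewrite (bigD1 (Ordinal lt_q)) //= nth_mkseq // eqxx mul1r nth_index //.
rewrite big1 ?addr0 // => i; rewrite -val_eqE /= => ne.
by rewrite nth_mkseq // (negPf ne) mul0r.
Qed.

End Ideal.

Lemma aut_inv {n : nat} (f : Pol n -> Pol n) : is_aut f ->
  exists g, [/\ cancel f g, cancel g f & is_aut g].
Proof.
move=> [fD fM fC [g fK gK]]; exists g; split=> //; split.
- by move=> p q; apply: (can_inj fK); rewrite fD !gK.
- by move=> p q; apply: (can_inj fK); rewrite fM !gK.
- by move=> c; rewrite -{1}fC fK.
- by exists f.
Qed.

(** Equality of the image ideal with the target is reduced to two checks on generators: [f] gives
    one inclusion, and [g] provides the preimages for the other. *)
Lemma equiv_var_cancel {n : nat} (ps qs : seq (Pol n)) (f g : Pol n -> Pol n) :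
  is_aut f -> is_aut g -> cancel f g -> cancel g f ->
  {in ps, forall p, in_ideal qs (f p)} -> {in qs, forall q, in_ideal ps (g q)} ->
  equiv_var ps qs.
Proof.
have map_ideal (rs ss : seq (Pol n)) (h : Pol n -> Pol n) : is_aut h ->
    {in rs, forall r, in_ideal ss (h r)} ->
    forall r, in_ideal rs r -> in_ideal ss (h r).
  move=> [hD hM hC _] hrs; apply: in_ideal_ind => [|p q hp hq|c p /hrs hp].
  - by rewrite -[X in h X]mpolyC0 hC mpolyC0; apply: in_ideal0.
  - by rewrite hD; apply: in_idealD.
  - by rewrite hM; apply: in_idealM.
move=> fA gA fK gK fps gqs; exists f; split=> // q; split=> [qQ|[p pP <-]].
  by exists (g q); rewrite ?gK //; apply: map_ideal qQ.
exact: map_ideal pP.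
Qed.

(** * Substitution homomorphisms and the automorphisms they define *)

Lemma XnE {n : nat} (i : 'I_n) : Xn n i = 'X_i.
Proof. by rewrite /Xn valK. Qed.

(* Locked: unification otherwise unfolds nested substitutions forever. *)
HB.lock Definition mpoly_subst {m n : nat} (t : nat -> Pol n) (p : Pol m) :
    Pol n :=
  p \mPo [tuple t i | i < m].

Lemma mpoly_substX {m n : nat} (t : nat -> Pol n) i :
  (i < m)%N -> mpoly_subst t (Xn m i) = t i.
Proof.
move=> im; rewrite (XnE (Ordinal im) : Xn m i = _).
rewrite mpoly_subst.unlock comp_mpolyXU.
by rewrite -tnth_nth tnth_mktuple.
Qed.

Section SubstMorphism.
Context {m n : nat} (t : nat -> Pol n).
Implicit Types p q : Pol m.

Lemma mpoly_substD p q :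
  mpoly_subst t (p + q) = mpoly_subst t p + mpoly_subst t q.
Proof. by rewrite mpoly_subst.unlock comp_mpolyD. Qed.

Lemma mpoly_substM p q :
  mpoly_subst t (p * q) = mpoly_subst t p * mpoly_subst t q.
Proof. by rewrite mpoly_subst.unlock rmorphM. Qed.

Lemma mpoly_substN p : mpoly_subst t (- p) = - mpoly_subst t p.
Proof. by rewrite mpoly_subst.unlock comp_mpolyN. Qed.

Lemma mpoly_substC c : mpoly_subst t (c%:MP : Pol m) = c%:MP.
Proof. by rewrite mpoly_subst.unlock comp_mpolyC. Qed.

Lemma mpoly_subst1 : mpoly_subst t (1 : Pol m) = 1.
Proof. by rewrite mpoly_subst.unlock comp_mpoly1. Qed.

End SubstMorphism.

Definition mpoly_substE :=
  (@mpoly_substD, @mpoly_substM, @mpoly_substN, @mpoly_substC, @mpoly_subst1).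

Lemma lift_polE {m n : nat} (p : Pol m) : lift_pol n p = mpoly_subst (Xn n) p.
Proof. by rewrite mpoly_subst.unlock. Qed.

Lemma mpoly_substK {n : nat} (s t : nat -> Pol n) :
  (forall i, (i < n)%N -> mpoly_subst t (s i) = Xn n i) ->
  cancel (@mpoly_subst n n s) (@mpoly_subst n n t).
Proof.
move=> st; apply: mpoly_alg_ind => [c|i|p q|p q].
- by rewrite !mpoly_substE.
- by rewrite -XnE mpoly_substX ?st.
- by rewrite !mpoly_substE => -> ->.
- by rewrite !mpoly_substE => -> ->.
Qed.

Lemma mpoly_subst_aut {n : nat} (s t : nat -> Pol n) :
  cancel (@mpoly_subst n n s) (@mpoly_subst n n t) ->
  cancel (@mpoly_subst n n t) (@mpoly_subst n n s) ->
  is_aut (@mpoly_subst n n s).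
Proof.
move=> sK tK; split=> [p q|p q|c|]; last by exists (mpoly_subst t).
- exact: mpoly_substD.
- exact: mpoly_substM.
- exact: mpoly_substC.
Qed.

(** * Cylinders and the derivative along the last variable *)

Lemma mderiv_lift_pol {n : nat} (p : Pol n) :
  (lift_pol n.+1 p)^`M(ord_max) = 0.
Proof.
rewrite lift_polE; elim/(@mpoly_alg_ind n CC): p => [c|i|p q|p q].
- by rewrite mpoly_substC mderivC.
- rewrite -XnE mpoly_substX //.
  have -> : val i = widen_ord (leqnSn n) i by [].
  rewrite XnE mderivX mnm1E -val_eqE /= (ltn_eqF (ltn_ord i)).
  by rewrite scale0r.
- by rewrite mpoly_substD mderivD => -> ->; rewrite addr0.
- by rewrite mpoly_substM mderivM => -> ->; rewrite mul0r mulr0 addr0.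
Qed.

Lemma cylinder_hypersurface {n : nat} (q : Pol n.+1) : cylinder [:: q] ->
  exists2 f, is_aut f & (f q)^`M(ord_max) = 0.
Proof.
move=> [ws [f [fA fideal]]]; exists f => //; have [fD fM fC _] := fA.
(* An ideal generated by polynomials free of the last variable is stable under the derivative along
   it, by the Leibniz rule. *)
have : in_ideal (map (@lift_pol n n.+1) ws) (f q)^`M(ord_max).
  have : in_ideal (map (@lift_pol n n.+1) ws) (f q).
    by apply/fideal; exists q => //; apply: in_ideal_mem; rewrite inE.
  move: (f q); apply: in_ideal_ind => [|p r|c p /mapP[w ww ->]].
  - by rewrite mderiv0; apply: in_ideal0.
  - by rewrite mderivD; apply: in_idealD.
  - rewrite mderivM mderiv_lift_pol mulr0 addr0; apply/in_idealM/in_ideal_mem.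
    exact: map_f.
(* Pulled back by [f], the ideal is principal with generator [q], so the derivative of [f q] is a
   multiple of [f q]. *)
move/fideal => [p [cs ->]]; rewrite /= big_ord1 /= fM => /esym.
exact: mderiv_dvd_eq0.
Qed.

(** * The cubic hypersurface is not a cylinder *)

(* [m] is the ambient dimension, [n] the number of variables involved: the same
   polynomial is needed in C^n and in C^(2n). *)
Definition quadric (m n : nat) : Pol m := \sum_(i < n | (1 < i)%N) Xn m i ^+ 2.

Definition cubic (m n : nat) : Pol m :=
  Xn m 0 * (Xn m 0 * Xn m 1 + quadric m n).

Lemma mpoly_subst_quadric {m n k : nat} (t : nat -> Pol n) : (k <= m)%N ->
  (forall i, (1 < i < k)%N -> t i = Xn n i) ->
  mpoly_subst t (quadric m k) = quadric n k.
Proof.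
move=> km tE.
have s0 : mpoly_subst t (0 : Pol m) = 0 by rewrite -mpolyC0 mpoly_substC mpolyC0.
rewrite /quadric (big_morph _ (mpoly_substD t) s0); apply: eq_bigr => i i1.
rewrite !expr2 mpoly_substM mpoly_substX ?tE ?i1 //=.
exact: leq_trans km.
Qed.

(** The Leibniz rule writes [D] of the cubic as a combination of quadratic forms with coefficients
    [D 'X_i]. Its degree-two coefficients see only the constant terms of these, and the monomials
    divisible by x separate them. *)
Lemma derivation_cubic {n : nat} (D : Pol n.+2 -> Pol n.+2) :
  (forall p q, D (p + q) = D p + D q) ->
  (forall p q, D (p * q) = D p * q + p * D q) ->
  D (cubic n.+2 n.+2) = 0 -> forall i, (D 'X_i)@_0%MM = 0.
Proof.
move=> DD DM; rewrite /cubic /quadric.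
set x := Xn _ 0; set y := Xn _ 1.
have ->: x = 'X_ord0 by rewrite -XnE.
have ->: y = 'X_(lift ord0 ord0) by rewrite -XnE.
set i0 := ord0; set i1 := lift _ _.
have D0 : D 0 = 0 by apply: (@addrI _ (D 0)); rewrite -DD !addr0.
rewrite DM DD DM (big_morph D DD D0).
set S := \sum_(i < _ | _) _; set T := \sum_(i < _ | _) _ => DP.
have {}DP : D 'X_i0 * ('X_i0 * 'X_i1) *+ 2 + D 'X_i0 * S
    + D 'X_i1 * ('X_i0 * 'X_i0) + 'X_i0 * T = 0.
  by rewrite -DP; ring.
(* [S] is the sum of the squares [z_i ^+ 2], none of which is divisible by x. *)
have Scoef k : (D 'X_i0 * S)@_(U_(i0) + U_(k))%MM = 0.
  rewrite mulr_sumr raddf_sum big1 //= => i i_gt1.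
  rewrite XnE expr2 mcoeffM_quadratic.
  have -> : (i == i0) = false by apply: contraTF i_gt1 => /eqP->.
  by rewrite andbF mulr0n.
have Tcoef k : ('X_i0 * T)@_(U_(i0) + U_(k))%MM =
    (D 'X_k)@_0%MM *+ 2 *+ (1 < k)%N.
  rewrite mulr_sumr raddf_sum /=.
  have E (i : 'I_n.+2) : (1 < i)%N ->
      ('X_i0 * D (Xn n.+2 i ^+ 2))@_(U_(i0) + U_(k))%MM =
      (D 'X_i)@_0%MM *+ 2 *+ (i == k).
    move=> i_gt1; rewrite XnE expr2 DM.
    have -> : 'X_i0 * (D 'X_i * 'X_i + 'X_i * D 'X_i) =
      D 'X_i * ('X_i0 * 'X_i) *+ 2 :> Pol _ by ring.
    rewrite mcoeffMn mcoeffM_quadratic eqxx /= mulrnAC.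
    have -> : (i == i0) = false by apply: contraTF i_gt1 => /eqP->.
    by rewrite andbF orbF.
  rewrite (eq_bigr _ E); have [k1|k1] := boolP (1 < k)%N.
    rewrite (bigD1 k) //= eqxx big1 ?addr0 // => i /andP[_ /negPf->].
    by rewrite mulr0n.
  rewrite big1 // => i i_gt1; suff -> : (i == k) = false by [].
  by apply: contraNF k1 => /eqP<-.
(* The coefficient of x times the variable of index [k]: index 1 isolates [D 'X_i0], index 0
   isolates [D 'X_i1], and any larger index isolates [D 'X_k], up to a factor 1 or 2. *)
have coef k : (D 'X_i0)@_0%MM *+ (i1 == k) *+ 2 + (D 'X_i1)@_0%MM *+ (i0 == k)
    + (D 'X_k)@_0%MM *+ 2 *+ (1 < k)%N = 0.
  have := congr1 (mcoeff (U_(i0) + U_(k))%MM) DP.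
  rewrite mcoeff0 !mcoeffD Scoef Tcoef !mcoeffM_quadratic -mulr2n.
  rewrite eqxx (_ : (i1 == i0) = false) //= andbF orbF addr0.
  by rewrite andbT orbb.
have C2 (c : CC) : c *+ 2 = 0 -> c = 0.
  by move/eqP; rewrite mulrn_eq0 /= => /eqP.
move=> k; have := coef k.
have [<-|/negPf k1] := eqVneq i1 k.
  have := coef i1; rewrite eqxx /= !mulr0n !addr0 => /C2 ->.
  by move=> _; have := coef i0; rewrite eqxx /= ?mul0rn ?mulr0n ?add0r ?addr0.
have [<-|/negPf k0] := eqVneq i0 k.
  by have := coef i1; rewrite eqxx /= !mulr0n !addr0 => /C2.
have -> : (1 < k)%N.
  by case: k k0 k1 => [[|[|k]] kn]; rewrite -?val_eqE.
by rewrite !mulr0n mul0rn !add0r => /C2.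
Qed.

Lemma not_cylinder_cubic {n : nat} : ~ cylinder [:: cubic n.+2 n.+2 - 1].
Proof.
move=> /cylinder_hypersurface[f fA fp0].
have [fD fM fC _] := fA; have [g [fK gK [gD gM gC _]]] := aut_inv f fA.
(* The derivative along the last variable, transported through [f]; it is again a derivation
   vanishing on constants. *)
pose D p := g (f p)^`M(ord_max).
have DD p q : D (p + q) = D p + D q by rewrite /D fD mderivD gD.
have DM p q : D (p * q) = D p * q + p * D q.
  by rewrite /D fM mderivM gD !gM !fK.
have DC c : D c%:MP = 0 by rewrite /D fC mderivC -[X in g X]mpolyC0 gC mpolyC0.
have Dp0 : D (cubic n.+2 n.+2) = 0.
  have -> : cubic n.+2 n.+2 = (cubic n.+2 n.+2 - 1) + 1%:MP by rewrite subrK.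
  by rewrite DD DC addr0 /D fp0 -[X in g X]mpolyC0 gC mpolyC0.
have DX := derivation_cubic D DD DM Dp0.
(* Vanishing at the origin spreads from the variables to all polynomials by the Leibniz rule. *)
have D_at0 p : (D p)@_0%MM = 0.
  elim/(@mpoly_alg_ind n.+2 CC): p => [c|//|p q|p q]; first by rewrite DC mcoeff0.
    by rewrite DD mcoeffD => -> ->; rewrite addr0.
  by rewrite DM mcoeffD !rmorphM /= => -> ->; rewrite mul0r mulr0 addr0.
(* The preimage under [f] of the last variable has [D] equal to 1, which does not vanish at the
   origin. *)
have := D_at0 (g 'X_ord_max); rewrite /D gK mderivX mnm1E eqxx scale1r
  -{1}[U_(_)%MM]add0m addmK.
rewrite mpolyX0 -mpolyC1 gC mcoeffC eqxx mulr1 => /eqP.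
by rewrite oner_eq0.
Qed.

(** * Equivalence after doubling the dimension *)

Lemma equiv_double_cubic {n : nat} : (2 < n)%N ->
  equiv_var (to_double [:: Xn n 0 * Xn n 1 - 1]) (to_double [:: cubic n n - 1]).
Proof.
move=> n_gt2; set N := (n + n)%N.
have nN : (n <= N)%N by rewrite leq_addr.
have ltN i : (i <= n)%N -> (i < N)%N.
  by move=> le_in; rewrite /N -addn1 leq_add // (leq_trans _ n_gt2).
have liftX i : (i < n)%N -> lift_pol N (Xn n i) = Xn N i
  by move=> lt_i; rewrite lift_polE mpoly_substX.
have n0 : (0 < n)%N by rewrite (leq_trans _ n_gt2).
have n1 : (1 < n)%N by rewrite (leq_trans _ n_gt2).
have lift_xy : lift_pol N (Xn n 0 * Xn n 1 - 1) = Xn N 0 * Xn N 1 - 1.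
  by rewrite -!liftX // !lift_polE !mpoly_substE.
have lift_Q : lift_pol N (quadric n n) = quadric N n 
  by rewrite lift_polE mpoly_subst_quadric.
have lift_cubic : lift_pol N (cubic n n - 1) = cubic N n - 1.
  by rewrite /cubic -lift_Q -!liftX // !lift_polE !mpoly_substE.
rewrite /to_double /= lift_xy lift_cubic.
set x := Xn N 0; set y := Xn N 1; set u := Xn N n; set Q := quadric N n.
(* Here [u] is the first added coordinate. The substitution [s] is built from the shear of [u] by
   [x * y + Q], the exchange of [y] and [u], and a shear by [w * (w - Q)]; undoing these in reverse
   order gives [t]. All other coordinates stay fixed. *)
pose w := u + x * y + Q; pose v := u + y * (y - Q).
pose s i := if i == 1%N then w else if i == n then y - w * (w - Q) else Xn N i.
pose t i := if i == 1%N then v else if i == n then y - x * v - Q else Xn N i.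
have ltn_n i : (1 < i < n)%N -> i == 1%N = false /\ i == n = false.
  by move=> /andP[i1 i_n]; split; [rewrite gtn_eqF|rewrite ltn_eqF].
have n_neq1 : (n == 1%N) = false by rewrite gtn_eqF.
have z_neqn : (0%N == n) = false by rewrite ltn_eqF.
have sx : mpoly_subst s x = x by rewrite mpoly_substX ?ltN // /s z_neqn.
have tx : mpoly_subst t x = x by rewrite mpoly_substX ?ltN // /t z_neqn.
have sy : mpoly_subst s y = w by rewrite mpoly_substX ?ltN // ltnW.
have ty : mpoly_subst t y = v by rewrite mpoly_substX ?ltN // ltnW.
have su : mpoly_subst s u = y - w * (w - Q)
  by rewrite mpoly_substX ?ltN // /s n_neq1 eqxx.
have tu : mpoly_subst t u = y - x * v - Q
  by rewrite mpoly_substX ?ltN // /t n_neq1 eqxx.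
have sQ : mpoly_subst s Q = Q.
  by apply: mpoly_subst_quadric => // i /ltn_n[i1 i_n]; rewrite /s i1 i_n.
have tQ : mpoly_subst t Q = Q.
  by apply: mpoly_subst_quadric => // i /ltn_n[i1 i_n]; rewrite /t i1 i_n.
have stK : cancel (@mpoly_subst N N s) (@mpoly_subst N N t).
  apply: mpoly_substK => i iN; rewrite /s.
  case: eqP => [->|i1]; first by rewrite /w !mpoly_substE tx ty tu tQ -/y; ring.
  case: eqP => [->|i_n]; first by rewrite /w !mpoly_substE tx ty tu tQ -/u /v; ring.
  by rewrite mpoly_substX // /t; case: eqP => // _; case: eqP.
have tsK : cancel (@mpoly_subst N N t) (@mpoly_subst N N s).
  apply: mpoly_substK => i iN; rewrite /t.
  case: eqP => [->|i1]; first by rewrite /v !mpoly_substE sy su sQ -/y /w; ring.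
  case: eqP => [->|i_n].
    by rewrite /v !mpoly_substE sx sy su sQ -/u /w; ring.
  by rewrite mpoly_substX // /s; case: eqP => // _; case: eqP.
have u_mem (p : Pol N) : u \in p :: [seq Xn N j | j <- iota n n].
  by rewrite inE map_f ?orbT // mem_iota leqnn -[X in (X < _)%N]addn0 ltn_add2l n0.
have fix_mem (r : nat -> Pol N) (p : Pol N) (j : nat) : j \in iota n n -> j != n ->
    r j = Xn N j ->
    in_ideal (p :: [seq Xn N j | j <- iota n n]) (mpoly_subst r (Xn N j)).
  move=> jn jnn rj; rewrite mpoly_substX ?rj; last first.
    by move: jn; rewrite mem_iota => /andP[].
  by apply: in_ideal_mem; rewrite inE map_f ?orbT.
have neq1 j : j \in iota n n -> (j == 1%N) = false.
  by rewrite mem_iota => /andP[nj _]; rewrite gtn_eqF // (leq_trans n1).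
apply: (equiv_var_cancel _ _ _ _ (mpoly_subst_aut _ _ stK tsK)
  (mpoly_subst_aut _ _ tsK stK) stK tsK).
- move=> p; rewrite inE => /orP[/eqP->|/mapP[j jn ->]].
    (* Modulo [u], [w] is [x * y + Q], so [x * w] is the cubic. *)
    have -> : mpoly_subst s (x * y - 1) = 1 * (cubic N n - 1) + x * u.
      by rewrite !mpoly_substE sx sy /cubic -/x -/y -/Q /w; ring.
    by apply: in_idealD; apply: in_idealM; apply: in_ideal_mem;
      rewrite ?u_mem // inE eqxx.
  have [->|jnn] := eqVneq j n; last first.
    by apply: fix_mem => //; rewrite /s neq1 // (negPf jnn).
  (* Modulo [u], [w * (w - Q)] is [y] times the cubic. *)
  have -> : mpoly_subst s (Xn N n) =
      (- y) * (cubic N n - 1) + (- (w + x * y)) * u.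
    by rewrite su /cubic -/x -/y -/Q /w; ring.
  by apply: in_idealD; apply: in_idealM; apply: in_ideal_mem;
    rewrite ?u_mem // inE eqxx.
- move=> p; rewrite inE => /orP[/eqP->|/mapP[j jn ->]].
    (* Modulo [u], the image is [x ^+ 2 * y * (y - Q) + x * Q - 1], which has the factor
       [x * y - 1]. *)
    have -> : mpoly_subst t (cubic N n - 1) =
        (1 + x * (y - Q)) * (x * y - 1) + x ^+ 2 * u.
      by rewrite /cubic -/x -/y -/Q !mpoly_substE tx ty tQ /v; ring.
    by apply: in_idealD; apply: in_idealM; apply: in_ideal_mem;
      rewrite ?u_mem // inE eqxx.
  have [->|jnn] := eqVneq j n; last first.
    by apply: fix_mem => //; rewrite /t neq1 // (negPf jnn).
  have -> : mpoly_subst t (Xn N n) = (Q - y) * (x * y - 1) + (- x) * u.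
    by rewrite tu /v; ring.
  by apply: in_idealD; apply: in_idealM; apply: in_ideal_mem;
    rewrite ?u_mem // inE eqxx.
Qed.

(** * Choice of V and U for given [k] and [n] *)

Theorem theorem1p6 (k n : nat) (hk : (1 <= k)%N) (hn : (k + 2 <= n)%N) :
  exists (vs : seq (Pol (n - k))) (us : seq (Pol n)),
    ~ cylinder us /\
    equiv_var (to_double (map (@lift_pol (n - k) n) vs)) (to_double us).
Proof.
have n_gt2 : (2 < n)%N by rewrite (leq_trans _ hn) // addn2 !ltnS.
(* Both x and y are thus coordinates of the smaller space, so [x * y - 1] can be written there. *)
have nk : (1 < n - k)%N by rewrite ltn_subRL -addnS.
exists [:: Xn (n - k) 0 * Xn (n - k) 1 - 1], [:: cubic n n - 1]; split.
  by case: n n_gt2 {hn nk} => [|[|n]] // _; apply: not_cylinder_cubic.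
rewrite (_ : map _ _ = [:: Xn n 0 * Xn n 1 - 1]); first exact: equiv_double_cubic.
have liftX i : (i < n - k)%N -> lift_pol n (Xn (n - k) i) = Xn n i
  by move=> lt_i; rewrite lift_polE mpoly_substX.
by rewrite /= -!liftX ?(ltnW nk) // !lift_polE !mpoly_substE.
Qed.
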